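(* If $X$ is a Baire space with a rank $2$-diagonal, then $$|X|\le wL(X)^{\omega}.$$
   Context: A Baire space is a topological space in which every countable intersection of dense open sets is dense. The weak Lindelöf number $wL(X)$ is the least cardinal $\kappa$ such that every open cover of $X$ has a subfamily of cardinality at most $\kappa$ whose union is dense in $X$. For a family $\mathcal{U}$ of subsets of $X$ and $A\subseteq X$, put $\mathrm{St}(A,\mathcal{U})=\bigcup\{U\in\mathcal{U}:A\cap U\ne\emptyset\}$, $\mathrm{St}(x,\mathcal{U})=\mathrm{St}(\{x\},\mathcal{U})$ and $\mathrm{St}^2(x,\mathcal{U})=\mathrm{St}(\mathrm{St}(x,\mathcal{U}),\mathcal{U})$. $X$ has a rank $2$-diagonal if there is a sequence $\{\mathcal{U}_n:n<\omega\}$ of open covers of $X$ such that for all $x\ne y$ in $X$ there is $n<\omega$ with $y\notin\mathrm{St}^2(x,\mathcal{U}_n)$. *)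

(* Defs.v *)
From mathcomp Require Import all_boot all_order.
From mathcomp Require Import boolp classical_sets functions cardinality topology.

Set Implicit Arguments.
Unset Strict Implicit.
Unset Printing Implicit Defensive.

Local Open Scope classical_set_scope.
Local Open Scope card_scope.

(* Cardinals are represented by sets [K : set T] over arbitrary types [T],
   compared with [#<=]; cardinal equality is [#=]. *)

Definition Baire_space (X : topologicalType) : Prop :=
  forall D : nat -> set X, (forall n, open (D n) /\ dense (D n)) ->
    dense (\bigcap_n D n).

Definition open_cover (X : topologicalType) (U : set (set X)) : Prop :=
  (forall A, U A -> open A) /\ \bigcup_(A in U) A = [set: X].

Definition St (X : Type) (A : set X) (U : set (set X)) : set X :=
  \bigcup_(V in [set V | U V /\ A `&` V !=set0]) V.

Definition rank2_diagonal (X : topologicalType) : Prop :=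
  exists U : nat -> set (set X),
    (forall n, open_cover (U n)) /\
    (forall x y : X, x <> y ->
       exists n, ~ St (St [set x] (U n)) (U n) y).

Definition weakly_Lindelof_upto (X : topologicalType) T (K : set T) : Prop :=
  forall U : set (set X), open_cover U ->
    exists V : set (set X),
      [/\ V `<=` U, V #<= K & dense (\bigcup_(A in V) A)].

(* A set of cardinality wL(X). A representative is sought among the subsets of
   [set X], which is enough because every open cover is such a subset; [wL_le]
   and [wLP] below show that it is least among all cardinals with the property.
   There is no convention that wL(X) be infinite. *)
Definition wL (X : topologicalType) : set (set X) :=
  xget set0 [set K : set (set X) | weakly_Lindelof_upto X K /\
    forall L : set (set X), weakly_Lindelof_upto X L -> K #<= L].

Arguments wL : clear implicits.

Lemma fun_card_le T U (A : set T) (B : set U) (f : T -> U) :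
  (forall x, A x -> B (f x)) ->
  (forall x y, A x -> A y -> f x = f y -> x = y) -> A #<= B.
Proof.
move=> fAB finj.
have [|g] := (@injfunPex _ _ A B).2.
  by exists f => [x Ax|x y /set_mem Ax /set_mem Ay]; [exact: fAB | exact: finj].
exact: inj_card_le.
Qed.

(* Every nonempty family of cardinals has a least element: in a maximal set [F]
   of choice functions that differ at every member of the family, some
   coordinate is exhausted. *)
Lemma least_card T (P : set (set T)) : P !=set0 ->
  exists2 K, P K & forall L, P L -> K #<= L.
Proof.
move=> [K0 PK0].
pose Q (F : set (set T -> T)) :=
  (forall f K, F f -> P K -> K (f K)) /\
  (forall f g K, F f -> F g -> P K -> f K = g K -> f = g).
have [G GQ Gtot|F [[Fin Finj] Fmax]] := @Zorn_bigcup _ Q.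
  split=> [f K [H GH Hf] PK|f g K [H GH Hf] [H' GH' H'g] PK fg].
    exact: ((GQ _ GH).1 f K Hf PK).
  have [HH'|H'H] := Gtot _ _ GH GH'.
    exact: ((GQ _ GH').2 f g K (HH' _ Hf) H'g PK fg).
  exact: ((GQ _ GH).2 f g K Hf (H'H _ H'g) PK fg).
have [[K [PK KF]]|noK] :=
    pselect (exists K, P K /\ forall t, K t -> exists2 f, F f & f K = t).
  exists K => // L PL.
  apply: (card_le_trans (B := F)).
    apply: (card_le_trans (B := (fun f => f K) @` F)).
      by apply: subset_card_le => t /KF[f Ff <-]; exists f.
    exact: card_image_le.
  apply: (fun_card_le (f := fun f => f L)) => [f Ff|f g Ff Fg fg].
    exact: (Fin f L Ff PL).
  exact: (Finj f g L Ff Fg PL fg).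
have new K : P K -> exists t, K t /\ forall f, F f -> f K <> t.
  move=> PK; apply: contrapT => H; apply: noK; exists K; split=> // t Kt.
  apply: contrapT => H'; apply: H; exists t; split=> // f Ff fKt.
  by apply: H'; exists f.
have [t0 _] := new _ PK0.
have /choice[h hP] : forall K, exists t, P K -> K t /\ forall f, F f -> f K <> t.
  move=> K; have [PK|nPK] := pselect (P K); last by exists t0.
  by have [t Ht] := new _ PK; exists t.
exfalso; apply: (Fmax (F `|` [set h])).
  split=> [f Ff|]; first by left.
  by move=> /(_ h (or_intror erefl)) Fh; have [_ /(_ h Fh)] := hP _ PK0.
split=> [f K [Ff|->] PK|f g K [Ff|->] [Fg|->] PK] //.
- exact: (Fin f K Ff PK).
- by have [] := hP _ PK.
- exact: (Finj f g K Ff Fg PK).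
- by move=> E; have [_ /(_ f Ff)] := hP K PK.
- by move=> E; have [_ /(_ g Fg) []] := hP K PK.
Qed.

Lemma card_le_total T U (A : set T) (B : set U) : A #<= B \/ B #<= A.
Proof.
pose A' : set (T + U) := inl @` A; pose B' : set (T + U) := inr @` B.
have AA' : A #<= A'.
  by apply: (fun_card_le (f := inl)) => [x Ax|x y _ _ []//]; exists x.
have BB' : B #<= B'.
  by apply: (fun_card_le (f := inr)) => [x Bx|x y _ _ []//]; exists x.
have [|K [->|->] Kle] := @least_card _ [set A'; B'].
- by exists A'; left.
- left; apply: (card_le_trans AA').
  by apply: (card_le_trans (Kle B' _)); [right | exact: card_image_le].
- right; apply: (card_le_trans BB').
  by apply: (card_le_trans (Kle A' _)); [left | exact: card_image_le].
Qed.

Lemma weakly_Lindelof_upto_le (X : topologicalType) T U (K : set T) (L : set U) :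
  K #<= L -> weakly_Lindelof_upto X K -> weakly_Lindelof_upto X L.
Proof.
move=> KL wK C /wK[V [VC VK dV]]; exists V; split=> //.
exact: card_le_trans VK KL.
Qed.

Lemma wL_subproof (X : topologicalType) :
  weakly_Lindelof_upto X (wL X) /\
  forall L : set (set X), weakly_Lindelof_upto X L -> wL X #<= L.
Proof.
rewrite /wL; case: xgetP => [K _ //|none]; exfalso.
have [|K wK Kle] := @least_card _ [set K : set (set X) | weakly_Lindelof_upto X K].
  exists setT => U [_ covU]; exists U; split=> //.
    by apply: subset_card_le.
  by rewrite covU => O [x Ox] _; exists x.
exact: (none K).
Qed.

Lemma wLP (X : topologicalType) : weakly_Lindelof_upto X (wL X).
Proof. exact: (wL_subproof X).1. Qed.

Lemma wL_le (X : topologicalType) T (L : set T) :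
  weakly_Lindelof_upto X L -> wL X #<= L.
Proof.
move=> wL'.
have [XL|LX] := card_le_total [set: set X] L.
  by apply: card_le_trans XL; apply: subset_card_le.
have [L0|/set0P[l0 _]] := eqVneq L set0.
  rewrite L0 in wL' *; apply: (card_le_trans (B := @set0 (set X))).
    by apply: (wL_subproof X).2; apply: weakly_Lindelof_upto_le wL'; exact: card_ge0.
  exact: card_ge0.
have /(@pcard_leP _ (set X))[f] := LX.
have Lf : L #= f @` L by rewrite card_eq_sym; apply: card_image.
have /card_eqPle[Lf1 Lf2] := Lf.
apply: card_le_trans Lf2; apply: (wL_subproof X).2.
exact: weakly_Lindelof_upto_le wL'.
Qed.

(* Main.v *)
(* By the weak Lindelof property each [U n] has a subfamily [V n] of size at
   most [wL X] with dense union; by the Baire property the intersection [G] of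
   these unions is dense. A point [g] of [G] is coded by a choice of members of
   [V n] containing it, one for each [n]: two points with the same code lie in
   [St] of each other for all [n]. A point [x] of [X] is coded by a sequence of
   points of [G], the [n]-th one in a member of [U n] containing [x]: two points
   with the same sequence lie in [St^2] of each other for all [n]. A double
   sequence in [wL X] is a sequence in [wL X], even if [wL X] is finite. *)
Require Import Defs.
From mathcomp Require Import all_boot all_order.
From mathcomp Require Import boolp classical_sets functions cardinality topology.

Local Open Scope classical_set_scope.
Local Open Scope card_scope.

Set Implicit Arguments.
Unset Strict Implicit.

Lemma card_le_exists_inj T (U : pointedType) (A : set T) (B : set U) :
  A #<= B -> exists f : T -> U,
    (forall x, A x -> B (f x)) /\
    (forall x y, A x -> A y -> f x = f y -> x = y).
Proof.
move=> /pcard_leP[f]; exists f; split=> [x Ax|x y Ax Ay]; first exact: funS.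
by apply: (@inj _ _ A f); apply: mem_set.
Qed.

Lemma mem_St2 (X : Type) (U : set (set X)) (x y z : X) (A B : set X) :
  U A -> U B -> A x -> A z -> B z -> B y -> St (St [set x] U) U y.
Proof.
move=> UA UB Ax Az Bz By; exists B => //; split=> //.
by exists z; split=> //; exists A => //; split=> //; exists x.
Qed.

Lemma open_cover_pick (X : topologicalType) (U : nat -> set (set X)) :
  (forall n, open_cover (U n)) ->
  exists W : X -> nat -> set X, forall x n, U n (W x n) /\ W x n x.
Proof.
move=> covU.
have covP (p : X * nat) : exists A, U p.2 A /\ A p.1.
  have : [set: X] p.1 by [].
  by rewrite -(covU p.2).2 => -[A UA Ax]; exists A.
by have [w wP] := choice covP; exists (fun x n => w (x, n)) => x n; exact: (wP (x, n)).
Qed.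

Theorem proposition4p5 (X : topologicalType)
    (hBaire : Baire_space X) (hdiag : rank2_diagonal X) :
  [set: X] #<= [set s : nat -> set X | forall n, wL X (s n)].
Proof.
have [U [covU sepU]] := hdiag.
have [W WP] := open_cover_pick covU.
have /choice[V VP] n := wLP (covU n).
have /choice[e eP] n : exists f : set X -> set X,
    (forall A, V n A -> wL X (f A)) /\
    (forall A B, V n A -> V n B -> f A = f B -> A = B).
  by have [_ Vle _] := VP n; exact: card_le_exists_inj.
pose G := \bigcap_n \bigcup_(A in V n) A.
have dG : dense G.
  apply: hBaire => n; have [VU _ dV] := VP n; split=> //.
  by apply: bigcup_open => A /VU; exact: (covU n).1.
have /choice[g gP] (p : X * nat) : exists z, G z /\ W p.1 p.2 z.
  have [UW Wx] := WP p.1 p.2.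
  have [|z [Wz Gz]] := dG (W p.1 p.2) _ ((covU p.2).1 _ UW); first by exists p.1.
  by exists z.
have /choice[v vP] (p : X * (nat * nat)) :
    exists A, V p.2.2 A /\ A (g (p.1, p.2.1)).
  by have [/(_ p.2.2 I)[A VA Ag] _] := gP (p.1, p.2.1); exists A.
(* The default [(0, 0)] is harmless: [pickle p] decodes to [p], so one sequence indexed by [k]
   already visits every pair. *)
pose unpair k : nat * nat := odflt (0, 0) (unpickle k).
apply: (fun_card_le (f := fun x k => e (unpair k).2 (v (x, unpair k)))).
  by move=> x _ k; apply: (eP _).1; exact: (vP (x, _)).1.
move=> x y _ _ exy; have vxy p : v (x, p) = v (y, p).
  apply: (eP p.2).2; [exact: (vP (x, p)).1 | exact: (vP (y, p)).1 |].
  by have := congr1 (@^~ (pickle p)) exy; rewrite /unpair pickleK.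
(* For each [m] both points lie in [v (x, (n, m))], a member of [U m]; taken as both links of the
   chain, it rules out separation at [m]. *)
have gxy n : g (x, n) = g (y, n).
  apply: contrapT => /sepU[m]; apply.
  have [/(_ (v (x, (n, m))))Uv _ _] := VP m; have [Vx vx] := vP (x, (n, m)).
  have [_ vy] := vP (y, (n, m)); rewrite -vxy in vy.
  exact: (mem_St2 (Uv Vx) (Uv Vx) vx vx vx vy).
(* The shared point [g (x, n)] links [W x n] to [W y n]. *)
apply: contrapT => /sepU[n]; apply.
have [UWx Wxx] := WP x n; have [UWy Wyy] := WP y n.
have [_ Wxg] := gP (x, n); have [_ Wyg] := gP (y, n); rewrite -gxy in Wyg.
exact: (mem_St2 UWx UWy Wxx Wxg Wyg Wyy).
Qed.
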